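(* Let $(X,r)$ be a solution with permutation left brace $B=\mathcal{G}(X,r)$, and suppose that the multiplicative group $(B,\circ)$ is isomorphic to a dihedral group of size $2^n\cdot m$ with $n>3$ and $m$ an odd number. Then the Dehornoy's class of $(X,r)$ is equal to $2^n\cdot m$ if $B$ is a cyclic left brace (i.e. $(B,+)$ is cyclic), and it is equal to $2^{n-1}\cdot m$ otherwise.
   Context: A solution is a pair $(X,r)$ with $X$ a non-empty set and $r:X\times X\to X\times X$, $r(x,y)=(\sigma_x(y),\tau_y(x))$, such that $(r\times \mathrm{id})(\mathrm{id}\times r)(r\times \mathrm{id})=(\mathrm{id}\times r)(r\times \mathrm{id})(\mathrm{id}\times r)$ on $X^3$, $r^2=\mathrm{id}$ (involutive), and all maps $\sigma_x,\tau_y:X\to X$ are bijections (non-degenerate). The permutation group $\mathcal{G}(X,r)$ is the subgroup of $\mathrm{Sym}(X)$ generated by all $\sigma_x$. A left brace is a set $B$ with two operations $+,\circ$ such that $(B,+)$ is an abelian group, $(B,\circ)$ is a group and $a\circ(b+c)=a\circ b-a+a\circ c$ for all $a,b,c$. Put $\lambda_a(b)=-a+a\circ b$. The permutation left brace of $(X,r)$ is $\mathcal{G}(X,r)$ with $\circ$ equal to composition and with the unique addition making it a left brace such that $\lambda_g(\sigma_x)=\sigma_{g(x)}$ for all $g\in\mathcal{G}(X,r)$, $x\in X$. Dehornoy's class: set $x\cdot y=\sigma_x^{-1}(y)$ and define $\Omega_k:X^k\to X$ by $\Omega_1(x_1)=x_1$ and $\Omega_k(x_1,\dots,x_k)=\Omega_{k-1}(x_1,\dots,x_{k-1})\cdot\Omega_{k-1}(x_1,\dots,x_{k-2},x_k)$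 for $k>1$. The Dehornoy's class of $(X,r)$ is the minimal positive integer $d$ such that $\Omega_{d+1}(x,x,\dots,x,y)=y$ for all $x,y\in X$. *)

(* Defs.v *)
From HB Require Import structures.
From mathcomp Require Import all_boot all_order all_algebra all_fingroup all_solvable.
From mathcomp Require Import boolp.

Set Implicit Arguments.
Unset Strict Implicit.
Unset Printing Implicit Defensive.

Import GRing.Theory.
Local Open Scope group_scope.

(* (B, +) is the zmodType structure and (B, o) is the (possibly infinite)
   groupType structure, whose product is written * in group_scope. *)
HB.mixin Record Zmodule_Group_isLeftBrace B
    of GRing.Zmodule B & monoid.Group B := {
  brace_mulD : forall a b c : B, a * (b + c)%R = ((a * b)%g - a + (a * c)%g)%R
}.

#[short(type="leftBraceType")]
HB.structure Definition LeftBrace :=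
  {B of GRing.Zmodule B & monoid.Group B & Zmodule_Group_isLeftBrace B}.

Definition brace_lambda (B : leftBraceType) (a b : B) : B := (- a + (a * b)%g)%R.

Definition cyclic_brace (B : leftBraceType) : Prop :=
  exists a : B, forall b : B, exists k : int, b = (a *~ k)%R.

Definition isomorphic_groups (G H : groupType) : Prop :=
  exists2 f : G -> H, bijective f & {morph f : a b / a * b}.

Record Sym (X : Type) := MkSym {
  sym_fun :> X -> X;
  sym_inv : X -> X;
  sym_funK : cancel sym_fun sym_inv;
  sym_invK : cancel sym_inv sym_fun
}.

Lemma sym_eqP (X : Type) (f g : Sym X) : f =1 g -> f = g.
Proof.
case: f g => [f f' fK f'K] [g g' gK g'K] /= /funext fg; subst g.
have fg' : f' = g' by apply/funext => x; rewrite -{1}(g'K x) fK.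
by subst g'; congr MkSym; exact: Prop_irrelevance.
Qed.

Section SymGroup.
Variable X : Type.
Implicit Types f g h : Sym X.

HB.instance Definition _ := gen_eqMixin (Sym X).
HB.instance Definition _ := gen_choiceMixin (Sym X).

Definition sym_one : Sym X := @MkSym X id id (frefl id) (frefl id).
Definition sym_mul f g : Sym X :=
  MkSym (can_comp (@sym_funK X f) (@sym_funK X g))
        (can_comp (@sym_invK X g) (@sym_invK X f)).
Definition sym_opp f : Sym X := MkSym (@sym_invK X f) (@sym_funK X f).

Lemma sym_mulA : associative sym_mul. Proof. by move=> f g h; exact: sym_eqP. Qed.
Lemma sym_mul1 : left_id sym_one sym_mul. Proof. by move=> f; exact: sym_eqP. Qed.
Lemma sym_1mul : right_id sym_one sym_mul. Proof. by move=> f; exact: sym_eqP. Qed.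
Lemma sym_mulV : left_inverse sym_one sym_opp sym_mul.
Proof. by move=> f; apply: sym_eqP => x /=; rewrite sym_funK. Qed.
Lemma sym_Vmul : right_inverse sym_one sym_opp sym_mul.
Proof. by move=> f; apply: sym_eqP => x /=; rewrite sym_invK. Qed.

HB.instance Definition _ :=
  isGroup.Build (Sym X) sym_mulA sym_mul1 sym_1mul sym_mulV sym_Vmul.

Lemma symME f g x : (f * g) x = f (g x). Proof. by []. Qed.
Lemma sym1E x : (1 : Sym X) x = x. Proof. by []. Qed.
Lemma symVK f : cancel f f^-1. Proof. exact: sym_funK. Qed.
Lemma symKV f : cancel f^-1 f. Proof. exact: sym_invK. Qed.

End SymGroup.

Definition sym_of_bij (X : Type) (f : X -> X) (bij_f : bijective f) : Sym X :=
  let inv := cid (let: Bijective g fK gK := bij_f in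
                  ex_intro (fun g => cancel f g /\ cancel g f) g (conj fK gK)) in
  MkSym (proj1 (projT2 inv)) (proj2 (projT2 inv)).

Definition generated_by (G : groupType) (A : G -> Prop) : {pred G} :=
  [pred g | `[< forall H : {pred G},
                  group_closed H -> (forall a, A a -> a \in H) -> g \in H >]].

Lemma generated_by_closed (G : groupType) (A : G -> Prop) :
  group_closed (generated_by A).
Proof.
split=> [|g h /asboolP Hg /asboolP Hh]; apply/asboolP => H gH AH.
  exact: gH.1.
by apply: gH.2; [exact: Hg | exact: Hh].
Qed.

Definition ybe_l (X : Type) (r : X * X -> X * X) (t : X * X * X) : X * X * X :=
  (r t.1, t.2).

Definition ybe_r (X : Type) (r : X * X -> X * X) (t : X * X * X) : X * X * X :=
  (t.1.1, (r (t.1.2, t.2)).1, (r (t.1.2, t.2)).2).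

(* r (x, y) = (sigma_x y, tau_y x). *)
Record solution (X : Type) := Solution {
  sol_map :> X * X -> X * X;
  sol_inhabited : inhabited X;
  sol_braid : forall t, ybe_l sol_map (ybe_r sol_map (ybe_l sol_map t))
                      = ybe_r sol_map (ybe_l sol_map (ybe_r sol_map t));
  sol_involutive : involutive sol_map;
  sol_sigma_bij : forall x, bijective (fun y => (sol_map (x, y)).1);
  sol_tau_bij : forall y, bijective (fun x => (sol_map (x, y)).2)
}.

Section Solution.
Variables (X : Type) (r : solution X).
Implicit Types x y z : X.

Definition sigma x : Sym X := sym_of_bij (sol_sigma_bij r x).
Definition tau y : Sym X := sym_of_bij (sol_tau_bij r y).

Lemma sol_mapE x y : r (x, y) = (sigma x y, tau y x).
Proof. exact: surjective_pairing. Qed.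

Definition cdot x y : X := (sigma x)^-1 y.

(* [Omega k] is the map usually written Omega_(k+1), of k+1 arguments:
   composing with [lift ord_max] drops the last argument, composing with
   [lift (inord k)] drops the last but one. *)
Fixpoint Omega (k : nat) : ('I_k.+1 -> X) -> X :=
  match k with
  | 0 => fun t => t ord0
  | k'.+1 => fun t => cdot (Omega (fun i : 'I_k'.+1 => t (lift ord_max i)))
                           (Omega (fun i : 'I_k'.+1 => t (lift (inord k') i)))
  end.

Definition dehornoy_trivial (d : nat) : Prop :=
  forall x y, Omega (fun i : 'I_d.+1 => if i < d then x else y) = y.

Definition is_dehornoy_class (d : nat) : Prop :=
  [/\ 0 < d, dehornoy_trivial d &
      forall e, 0 < e -> dehornoy_trivial e -> d <= e].

Definition in_perm_group : {pred Sym X} :=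
  generated_by (fun g => exists x, g = sigma x).

Record perm_group := PermGroup {
  perm_val :> Sym X;
  _ : perm_val \in in_perm_group
}.

HB.instance Definition _ := [isSub for perm_val].
HB.instance Definition _ := [Choice of perm_group by <:].
HB.instance Definition _ :=
  SubChoice_isSubGroup.Build (Sym X) in_perm_group perm_group
    (generated_by_closed _).

Lemma sigma_in_perm_group x : sigma x \in in_perm_group.
Proof. by apply/asboolP => H _; apply; exists x. Qed.

Definition gsigma x : perm_group := PermGroup (sigma_in_perm_group x).

Implicit Types g h k : perm_group.

Lemma perm_group_ext g h : (forall x, g x = h x) -> g = h.
Proof. by move=> gh; apply: val_inj; apply: sym_eqP. Qed.

Lemma perm_group_ind (P : perm_group -> Prop) :
    P 1 -> (forall g h, P g -> P h -> P (g * h^-1)) ->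
    (forall x, P (gsigma x)) -> forall g, P g.
Proof.
move=> P1 PM Ps g.
pose H : {pred Sym X} := [pred u | `[< exists2 h, val h = u & P h >]].
have : val g \in H.
  have /asboolP := valP g; apply.
    split=> [|u v /asboolP[h <- Ph] /asboolP[k <- Pk]]; apply/asboolP.
      by exists 1.
    by exists (h * k^-1); [exact/sym_eqP | exact: PM].
  by move=> _ [x ->]; apply/asboolP; exists (gsigma x).
by move=> /asboolP[h /val_inj <-].
Qed.

(* The addition of the permutation left brace is forced by
   lambda_g(sigma_x) = sigma_(g x), which means that
   sigma_x + g = g o sigma_(g^-1 x) for all g and x, see [shift].  These
   translations are commuting permutations of the permutation group, and they
   generate a regular group of permutations.  The resulting addition satisfies
   [perm_brace_lambda] and is the only one to do so, by [perm_brace_unique]. *)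

Definition square x : X := (sigma x)^-1 x.
Definition unsquare y : X := (tau y)^-1 y.

Lemma sol_invol_sigma x y : sigma (sigma x y) (tau y x) = x.
Proof. by have := sol_involutive r (x, y); rewrite !sol_mapE => -[]. Qed.

Lemma cdot_tau x y : cdot (sigma x y) x = tau y x.
Proof. by rewrite /cdot -{2}(sol_invol_sigma x y) symVK. Qed.

Lemma squareK : cancel square unsquare.
Proof.
move=> x; rewrite /unsquare; apply: (canLR (symVK _)).
by rewrite -cdot_tau /square symKV.
Qed.

Lemma unsquareK : cancel unsquare square.
Proof.
move=> y; rewrite /square; apply: (canLR (symVK _)).
set z := unsquare y; have zy : tau y z = y by exact: symKV.
apply: (can_inj (symVK (tau y))); rewrite zy.
by have := sol_involutive r (z, y); rewrite !sol_mapE zy => -[].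
Qed.

Lemma sol_braid_sigma x y z :
  sigma x (sigma y z) = sigma (sigma x y) (sigma (tau y x) z).
Proof. exact/esym/(congr1 (fun t => t.1.1) (sol_braid r (x, y, z))). Qed.

Lemma sigma_cdot x y :
  gsigma x * gsigma (cdot x y) = gsigma y * gsigma (cdot y x).
Proof.
apply: perm_group_ext => z.
have xy : sigma x (cdot x y) = y by exact: symKV.
have := sol_braid_sigma x (cdot x y) z.
by rewrite -cdot_tau xy.
Qed.

Definition shift x g : perm_group := g * gsigma (g^-1 x).
Definition unshift x g : perm_group := g * (gsigma (unsquare (g^-1 x)))^-1.

Lemma gmulV_app g h x : (g * h)^-1 x = h^-1 (g^-1 x).
Proof. by rewrite invgM. Qed.

Lemma shiftK x : cancel (shift x) (unshift x).
Proof.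
move=> g; rewrite /unshift /shift gmulV_app.
have -> : (gsigma (g^-1 x))^-1 (g^-1 x) = square (g^-1 x) by [].
by rewrite squareK mulgK.
Qed.

Lemma unshiftK x : cancel (unshift x) (shift x).
Proof.
move=> g; rewrite /unshift /shift gmulV_app invgK; set w := unsquare _.
have -> : gsigma w (g^-1 x) = w by rewrite -[g^-1 x]unsquareK; exact: symKV.
by rewrite mulgVK.
Qed.

Lemma shiftC x y g : shift x (shift y g) = shift y (shift x g).
Proof.
rewrite /shift !gmulV_app -!mulgA; congr (g * _).
exact: (sigma_cdot (g^-1 y) (g^-1 x)).
Qed.

Inductive translation : (perm_group -> perm_group) -> Prop :=
| translation_id : translation id
| translation_shift x a : translation a -> translation (shift x \o a)
| translation_unshift x a : translation a -> translation (unshift x \o a).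

Lemma translation_shift1 x : translation (shift x).
Proof. exact: (translation_shift x translation_id). Qed.

Lemma translation_unshift1 x : translation (unshift x).
Proof. exact: (translation_unshift x translation_id). Qed.

Lemma translation_comp a b :
  translation a -> translation b -> translation (a \o b).
Proof.
move=> ta tb; elim: ta => [//|x c _ IH|x c _ IH].
  exact: (@translation_shift x (c \o b)).
exact: (@translation_unshift x (c \o b)).
Qed.

Lemma translation_shiftC a x g :
  translation a -> a (shift x g) = shift x (a g).
Proof.
elim=> //= y c _ ->; first exact: shiftC.
by apply: (canLR (shiftK y)); rewrite shiftC unshiftK.
Qed.

Lemma translation_unshiftC a x g :
  translation a -> a (unshift x g) = unshift x (a g).
Proof.
by move=> ta; apply: (canRL (shiftK x)); rewrite -translation_shiftC ?unshiftK.
Qed.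

Lemma translationC a b g :
  translation a -> translation b -> a (b g) = b (a g).
Proof.
move=> ta; elim=> //= x c _ <-; first exact: translation_shiftC.
exact: translation_unshiftC.
Qed.

Lemma translation_inv a :
  translation a -> exists b, [/\ translation b, cancel a b & cancel b a].
Proof.
elim=> [|x c _ [d [td cK dK]]|x c _ [d [td cK dK]]].
  by exists id; split=> //; exact: translation_id.
  exists (d \o unshift x); split=> [|g|g] /=.
  - by apply: translation_comp => //; exact: translation_unshift1.
  - by rewrite shiftK cK.
  - by rewrite dK unshiftK.
exists (d \o shift x); split=> [|g|g] /=.
- by apply: translation_comp => //; exact: translation_shift1.
- by rewrite unshiftK cK.
- by rewrite dK shiftK.
Qed.

Lemma translation_mul h g : exists2 a, translation a & a h = h * g.
Proof.
elim/perm_group_ind: g h => [|g k IHg IHk|x] h.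
- by exists id; [exact: translation_id | rewrite mulg1].
- have [a ta ah] := IHg h; have [b tb bh] := IHk (h * (g * k^-1)).
  have [c [tc bK _]] := translation_inv tb.
  exists (c \o a); first exact: translation_comp.
  by rewrite /= ah -(bK (h * (g * k^-1))) bh -!mulgA mulVg mulg1.
- exists (shift (h x)); first exact: translation_shift1.
  by rewrite /shift (symVK h x : h^-1 (h x) = x).
Qed.

Lemma translation_to g : exists a, translation a /\ a 1 = g.
Proof. by have [a ta] := translation_mul 1 g; rewrite mul1g; exists a. Qed.

Definition gtrans g := projT1 (cid (translation_to g)).
Lemma gtransP g : translation (gtrans g).
Proof. exact: (proj1 (projT2 (cid (translation_to g)))). Qed.
Lemma gtrans1 g : gtrans g 1 = g.
Proof. exact: (proj2 (projT2 (cid (translation_to g)))). Qed.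

Lemma translation_eq a b :
  translation a -> translation b -> a 1 = b 1 -> a =1 b.
Proof.
move=> ta tb ab g; rewrite -(gtrans1 g).
by rewrite !(translationC _ _ (gtransP g)) ?ab.
Qed.

(* g + h is obtained by applying to h the translation that sends 1 to g. *)
Definition gadd g h : perm_group := gtrans g h.

Lemma translation_gadd a g : translation a -> a g = gadd (a 1) g.
Proof.
by move=> ta; apply: (translation_eq ta (gtransP _)); rewrite gtrans1.
Qed.

Lemma gadd_neg_ex g : exists h, gadd h g = 1.
Proof.
have [b [tb aK _]] := translation_inv (gtransP g).
by exists (b 1); rewrite -translation_gadd // -{1}(gtrans1 g) aK.
Qed.

Definition gopp g : perm_group := projT1 (cid (gadd_neg_ex g)).

Lemma gaddC : commutative gadd.
Proof.
move=> g h; rewrite /gadd -{1}(gtrans1 h) -{2}(gtrans1 g).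
by apply: translationC; exact: gtransP.
Qed.

Lemma gaddA : associative gadd.
Proof.
move=> g h k; rewrite /gadd.
apply: (translation_eq (a := gtrans g \o gtrans h)).
- by apply: translation_comp; exact: gtransP.
- exact: gtransP.
- by rewrite /= !gtrans1.
Qed.

Lemma gadd0 : left_id 1 gadd.
Proof. by move=> g; rewrite gaddC /gadd gtrans1. Qed.

Lemma gaddN : left_inverse 1 gopp gadd.
Proof. by move=> g; exact: (projT2 (cid (gadd_neg_ex g))). Qed.

HB.instance Definition _ :=
  Algebra.isZmodule.Build perm_group gaddA gaddC gadd0 gaddN.

Lemma shiftJ g x h : g * shift x h = shift (g x) (g * h).
Proof.
by rewrite /shift gmulV_app (symVK g x : g^-1 (g x) = x) mulgA.
Qed.

Lemma unshiftJ g x h : g * unshift x h = unshift (g x) (g * h).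
Proof. by apply: (canRL (shiftK _)); rewrite -shiftJ unshiftK. Qed.

Lemma translationJ g a : translation a ->
  exists2 b, translation b & forall h, g * a h = b (g * h).
Proof.
elim=> [|x c _ [b tb bE]|x c _ [b tb bE]]; first by exists id => //; exact: translation_id.
  exists (shift (g x) \o b); first exact: translation_shift.
  by move=> h /=; rewrite shiftJ bE.
exists (unshift (g x) \o b); first exact: translation_unshift.
by move=> h /=; rewrite unshiftJ bE.
Qed.

Lemma perm_group_mulD g h k : g * (h + k)%R = ((g * h)%g - g + (g * k)%g)%R.
Proof.
have [b tb bE] := translationJ g (gtransP h).
have [c tc cE] := translationJ g (gtransP k).
have -> : g * (h + k)%R = b (c g).
  by rewrite -{2}(mulg1 g) -cE -bE gtrans1.
have -> : g * h = b g by rewrite -{2}(mulg1 g) -bE gtrans1.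
have -> : g * k = c g by rewrite -{2}(mulg1 g) -cE gtrans1.
have addE u v : gadd u v = (u + v)%R by [].
rewrite (translation_gadd (c g) tb) (translation_gadd g tc).
by rewrite (translation_gadd g tb) !addE addrK.
Qed.

HB.instance Definition _ :=
  Zmodule_Group_isLeftBrace.Build perm_group perm_group_mulD.

Lemma shiftE x g : shift x g = (gsigma x + g)%R.
Proof.
rewrite (translation_gadd g (translation_shift1 x)); congr gadd.
by rewrite /shift mul1g invg1.
Qed.

Lemma perm_brace_lambda g x : brace_lambda g (gsigma x) = gsigma (g x).
Proof.
apply: (canLR (addKr g)); rewrite addrC -shiftE /shift.
by rewrite (symVK g x : g^-1 (g x) = x).
Qed.

Lemma perm_brace_unique (add : perm_group -> perm_group -> perm_group)
    (zero : perm_group) (opp : perm_group -> perm_group) :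
    associative add -> commutative add -> left_id zero add ->
    left_inverse zero opp add ->
    (forall g h k, g * add h k = add (add (g * h) (opp g)) (g * k)) ->
    (forall g x, add (opp g) (g * gsigma x) = gsigma (g x)) ->
  forall g h, add g h = (g + h)%R.
Proof.
move=> addA addC add0 addN addM addl.
have addK g h : add g (add (opp g) h) = h by rewrite addA (addC g) addN add0.
have addVK g h : add (opp g) (add g h) = h by rewrite addA addN add0.
have zero1 : zero = 1.
  have := addM 1 1 zero; rewrite !mul1g (addC 1) !add0 (addC 1) addN add0.
  by move<-.
have shE x g : shift x g = add (gsigma x) g.
  rewrite /shift -{1}(addK g (g * _)) addl addC.
  by rewrite (symKV g x : g (g^-1 x) = x).
have ushE x g : unshift x g = add (opp (gsigma x)) g.
  by rewrite -{2}(unshiftK x g) shE addVK.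
have tE a g : translation a -> a g = add (a 1) g.
  elim=> [|x c _ IH|x c _ IH] /=; first by rewrite -zero1 add0.
    by rewrite !shE IH addA.
  by rewrite !ushE IH addA.
by move=> g h; rewrite -{1}(gtrans1 g) -tE //; exact: gtransP.
Qed.

End Solution.

(* Main.v *)
Require Import Defs.
From HB Require Import structures.
From mathcomp Require Import all_boot all_order all_algebra.
From mathcomp Require Import all_fingroup all_solvable.
From mathcomp Require Import boolp ring zify.

(** Let B be the permutation brace.  The value Omega_(d+1)(x, ..., x, y) is the
    image of y under the inverse of the d-fold additive multiple of sigma_x, so
    the Dehornoy class is the exponent of (B, +), the sigma_x being additive
    generators ([dehornoy_trivialE]).  An abelian group of order 2^n m is cyclic
    exactly when its exponent is 2^n m ([zmod_exponent]); hence both cases follow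
    once 2^(n-1) m is known to divide the exponent ([dihedral_brace_torsion]).

    This is checked one prime p at a time.  The additive p-torsion of B is stable
    under the maps lambda_a, hence is a subgroup H of the dihedral group.  It
    meets the rotations in a cyclic group <c> of order p^f, where p^f is the
    exact power of p in 2^(n-1) m, and it suffices to see that p^(f-1) c is not
    zero.  Write lambda for lambda_c.  The powers of c for o are
    c^j = (1 + lambda + ... + lambda^(j-1)) c, so they can be computed in the
    ring K = Z[t] obtained from Z[X] by dividing out the polynomials that
    annihilate c when X acts as lambda: c^j corresponds to the geometric sum
    geom t j ([orbit_ringP]).  In K both p and s = t - 1 are nilpotent, so that
    K behaves like a local ring.  If p^e divides geom t (p^e) for some
    0 < e < f, then p^(f-1) divides geom t (p^(f-1)) ([geom_prime_lift]), and
    p^(f-1) c = 0 would force c^(p^(f-1)) = 1.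

    For odd p, all of H consists of powers of c; in particular s is a
    geometric sum, and e = 1 works ([geom_odd_prime]), the case f = 1 being just
    that c is not zero.  For p = 2 the elements
    of H that are not powers of c are involutions that invert c and form a single
    coset of <c>.  Each of 2 c and s^2 c either satisfies the resulting relations
    or is a power of c, and this makes e = 2 work ([geom4_dvd4], [dihedral_2torsion]). *)

Set Implicit Arguments.
Unset Strict Implicit.
Unset Printing Implicit Defensive.

Import GRing.Theory.

(** * Nilpotent elements and geometric sums in commutative rings *)

Section NilpotentElements.
Variable K : comNzRingType.
Implicit Types d u v w x y : K.
Local Open Scope ring_scope.

Definition nilelt x := exists k, x ^+ k = 0.

Lemma nileltMr x y : nilelt x -> nilelt (x * y).
Proof. by move=> [k xk]; exists k; rewrite exprMn xk mul0r. Qed.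

Lemma nileltD x y : nilelt x -> nilelt y -> nilelt (x + y).
Proof.
move=> [k xk] [l yl]; have [w wE] : exists w, (x + y) ^+ l = x * w + y ^+ l.
  elim: l {yl} => [|l [w IH]]; first by exists 0; rewrite mulr0 add0r.
  by exists ((x + y) * w + y ^+ l); rewrite exprS IH exprS; ring.
by exists (l * k)%N; rewrite exprM wE yl addr0 exprMn xk mul0r.
Qed.

Lemma nilelt_rootX k x : nilelt (x ^+ k) -> nilelt x.
Proof. by move=> [l xl]; exists (k * l)%N; rewrite exprM. Qed.

(** Modulo p, the p-th power of x - 1 is x^p - 1; descend along the powers of
    p. *)
Lemma nilelt_subr1 (p k : nat) x :
  prime p -> nilelt (p%:R : K) -> x ^+ (p ^ k) = 1 -> nilelt (x - 1).
Proof.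
move=> p_pr np; elim: k x => [|k IH] x xp1.
  by exists 1%N; rewrite expr1 -xp1 expr1 subrr.
have [z zE] : exists z, x ^+ p = 1 + (x - 1) ^+ p + p%:R * z.
  have -> : x ^+ p = \sum_(i < p.+1) (x - 1) ^+ i *+ 'C(p, i).
    by rewrite -{1}(subrK 1 x) exprD1n.
  case: p p_pr {IH np xp1} => // p p_pr.
  rewrite big_ord_recl big_ord_recr /= bin0 /bump /= add1n binn !mulr1n expr0.
  suff [z ->] : exists z, \sum_(i < p) (x - 1) ^+ (1 + i) *+ 'C(p.+1, 1 + i)
      = p.+1%:R * z by exists z; ring.
  elim/big_ind: _ => [|_ _ [a ->] [b ->]|i _]; first by exists 0; rewrite mulr0.
    by exists (a + b); rewrite mulrDr.
  have /dvdnP[q ->] : (p.+1 %| 'C(p.+1, 1 + i))%N.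
    by apply: prime_dvd_bin => //; rewrite add1n; exact: (ltn_ord i).
  by exists ((x - 1) ^+ (1 + i) * q%:R); rewrite -mulr_natl natrM; ring.
apply: (@nilelt_rootX p); have -> : (x - 1) ^+ p = (x ^+ p - 1) + p%:R * - z.
  by rewrite zE; ring.
by apply: nileltD (nileltMr _ np); apply: IH; rewrite -exprM -expnS.
Qed.

(** Nakayama's lemma for the principal ideal generated by y: iterating the
    hypothesis replaces the factor x by any of its powers. *)
Lemma nilelt_absorb d u x y :
  nilelt x -> y = d * u + x * y -> exists v, y = d * v.
Proof.
move=> [k xk] yE; have : exists v, y = d * v + x ^+ k * y.
  elim: k {xk} => [|k [v IH]]; first by exists 0; rewrite mulr0 add0r mul1r.
  by exists (v + x ^+ k * u); rewrite {1}IH {1}yE exprS; ring.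
by rewrite xk mul0r => -[v]; rewrite addr0; exists v.
Qed.

Lemma nilelt_fixed x y : nilelt x -> y = x * y -> y = 0.
Proof.
move=> nx yE; have [|v ->] := @nilelt_absorb 0 0 x y nx; last exact: mul0r.
by rewrite mul0r add0r.
Qed.

(** Two nilpotent elements generate a proper ideal. *)
Lemma nilelt2_neq1 x y u v : nilelt x -> nilelt y -> x * u + y * v <> 1.
Proof.
move=> nx ny E; have [|w xw] := @nilelt_absorb x u (y * v) 1 (nileltMr v ny).
  by rewrite mulr1 E.
have : (1 : K) == 0; last by rewrite oner_eq0.
by apply/eqP/(nilelt_fixed (nileltMr w nx)); rewrite -xw mulr1.
Qed.

End NilpotentElements.

Section GeometricSums.
Variable K : comNzRingType.
Implicit Types t u v w x y : K.
Local Open Scope ring_scope.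

Definition geom t j := \sum_(i < j) t ^+ i.

Lemma geom_mulB1 t j : (t - 1) * geom t j = t ^+ j - 1.
Proof. by rewrite subrX1. Qed.

Lemma geomS t j : geom t j.+1 = 1 + t * geom t j.
Proof.
rewrite /geom big_ord_recl expr0 mulr_sumr; congr (_ + _).
by apply: eq_bigr => i _; rewrite exprS.
Qed.

Lemma geomD t i j : geom t (i + j) = geom t i + t ^+ i * geom t j.
Proof.
elim: i => [|i IH]; first by rewrite /geom big_ord0 add0r mul1r.
by rewrite addSn !geomS IH exprS; ring.
Qed.

Lemma geomM t i j : geom t (i * j) = geom t i * geom (t ^+ i) j.
Proof.
elim: j => [|j IH]; first by rewrite muln0 /geom !big_ord0 mulr0.
by rewrite mulnS geomD IH geomS; ring.
Qed.

Lemma geom_expand2 t j : exists w,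
  geom t j = j%:R + 'C(j, 2)%:R * (t - 1) + (t - 1) ^+ 2 * w.
Proof.
elim: j => [|j [w IH]].
  by exists 0; rewrite /geom big_ord0 bin0n mulr0n; ring.
exists ('C(j, 2)%:R + t * w); rewrite geomS IH binS bin1 natrD -natr1; ring.
Qed.

Lemma geom_expand1 t j : exists w, geom t j = j%:R + (t - 1) * w.
Proof.
by have [w ->] := geom_expand2 t j; eexists; rewrite -addrA; congr (_ + _);
   rewrite expr2 -mulrA [_%:R * _]mulrC -mulrDr.
Qed.

Lemma geom2 t : geom t 2 = 2 + (t - 1).
Proof. by rewrite /geom !big_ord_recl big_ord0 /=; ring. Qed.

Lemma geom4 t : geom t 4 = (2 + (t - 1)) * (2 + 2 * (t - 1) + (t - 1) ^+ 2).
Proof. by rewrite /geom !big_ord_recl big_ord0 /bump /=; ring. Qed.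

(** The factor by which geom t (p^f) is multiplied to get geom t (p^(f+1)) is
    the geometric sum of length p of t^(p^f); it is congruent to p modulo
    t^(p^f) - 1, which is itself a multiple of p as f > 0. *)
Lemma geom_prime_lift (p e : nat) t : (0 < e)%N ->
    (exists y, geom t (p ^ e) = (p ^ e)%:R * y) ->
  forall f, (e <= f)%N -> exists y, geom t (p ^ f) = (p ^ f)%:R * y.
Proof.
move=> e_gt0 ge f; elim: f => [|f IH].
  by move=> e_le0; rewrite ltnNge e_le0 in e_gt0.
rewrite leq_eqVlt => /predU1P[<- //|le_ef].
have f_gt0 : (0 < f)%N by apply: leq_trans e_gt0 _.
have [y yE] := IH le_ef; rewrite expnSr geomM yE.
have [w ->] := geom_expand1 (t ^+ (p ^ f)) p.
rewrite -geom_mulB1 yE; exists (y * (1 + (t - 1) * (p ^ f.-1)%:R * y * w)).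
by rewrite -{2}(prednK f_gt0) expnS !natrM; ring.
Qed.

(** Reducing s = t - 1 = geom t j modulo s shows that p divides j, and then s is
    a multiple of geom t p, which lies in the ideal (p, s^2) because p divides
    'C(p, 2).  As s is nilpotent, p divides s, hence geom t p.  This is where p
    must be odd: for p = 2 only geom t 2 = 2 + s is known. *)
Lemma geom_odd_prime (p j : nat) t : prime p -> odd p ->
    nilelt (p%:R : K) -> nilelt (t - 1) -> t - 1 = geom t j ->
  exists y, geom t p = p%:R * y.
Proof.
move=> p_pr p_odd np ns sE; set s := t - 1 in ns sE *.
have p_gt2 : (2 < p)%N by rewrite odd_prime_gt2.
have [w] := geom_expand2 t p; rewrite -/s => pE.
have [q qE] : exists q, 'C(p, 2) = (p * q)%N.
  by have /dvdnP[q ->] := @prime_dvd_bin 2 p p_pr p_gt2; exists q; rewrite mulnC.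
have [v sv] : exists v, s = p%:R * v.
  have [/dvdnP[i ij]|/negbTE ndv] := boolP (p %| j)%N.
    move: sE; rewrite ij mulnC geomM pE qE; set x := geom _ i => sE.
    apply: (@nilelt_absorb _ _ ((1 + q%:R * s) * x) (s * (w * x))) => //.
      exact: nileltMr.
    by rewrite {1}sE natrM; ring.
  have [a] := geom_expand1 t j; rewrite -/s => aE.
  have j_gt0 : (0 < j)%N by case: j ndv {sE aE} => //; rewrite dvdn0.
  have [k l kl _] := egcdnP p j_gt0.
  have cop : gcdn j p = 1%N.
    by apply/eqP; rewrite -/(coprime j p) coprime_sym prime_coprime // ndv.
  rewrite cop in kl.
  case: (@nilelt2_neq1 _ p%:R s (- l%:R) ((1 - a) * k%:R)) => //.
  have jE : j%:R = s * (1 - a) by rewrite mulrBr mulr1 {1}sE aE; ring.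
  by rewrite mulrA -jE -natrM mulnC kl natrD natrM; ring.
exists (1 + q%:R * s + s * v * w).
by rewrite pE qE natrM expr2 {2}sv; ring.
Qed.

(** Let s = t - 1.  If j is odd then geom t j is 1 modulo 2 and s, which the
    hypothesis excludes.  If j is twice an odd number then geom t j is s modulo
    2 and s^2, so that s lies in (2, s^2) and 2 divides s. *)
Lemma geom_mod4 t j u w : nilelt (2 : K) -> nilelt (t - 1) ->
    geom t j = 2 * u + (t - 1) ^+ 2 * w ->
  (exists v, t - 1 = 2 * v) \/ exists x, geom t j = geom t 4 * x.
Proof.
move=> n2 ns; set s := t - 1 in ns *.
have oddE i : odd i -> i%:R = 1 + 2 * (i./2)%:R :> K.
  by move=> oi; rewrite -{1}(odd_double_half i) oi natrD -mul2n natrM.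
have [oj|ej] := boolP (odd j) => jE.
  have [a] := geom_expand1 t j; rewrite -/s => aE.
  case: (@nilelt2_neq1 _ 2 s (u - (j./2)%:R) (s * w - a)) => //.
  transitivity (2 * u + s ^+ 2 * w - (2 * (j./2)%:R + s * a)); first by ring.
  by rewrite -jE aE oddE //; ring.
have jh : j = (2 * j./2)%N by rewrite mul2n halfK (negbTE ej) subn0.
move: jE; rewrite jh; set i := j./2; have [oi|ei] := boolP (odd i) => jE.
  left; have [a aE] := geom_expand1 (t ^+ 2) i.
  have tE : t ^+ 2 - 1 = 2 * s + s ^+ 2 by rewrite /s; ring.
  rewrite geomM geom2 aE -/s tE (oddE _ oi) in jE; set h := (i./2)%:R in jE.
  pose z := u - (1 + 2 * h + (2 * s + s ^+ 2) * a) - s * (h + s * a).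
  apply: (@nilelt_absorb _ _ z (s * (w - s * a))); first exact: nileltMr.
  transitivity (2 * u + s ^+ 2 * w - (2 * u + s ^+ 2 * w - s)); first by ring.
  by rewrite -{2}jE /z; ring.
right; exists (geom (t ^+ 4) i./2).
by rewrite -geomM; congr geom; rewrite -{1}(odd_double_half i) (negbTE ei); lia.
Qed.

Definition geometric t x := exists j, x = geom t j.

(** The three disjunctive hypotheses record what a reflection says about the
    elements 2 and s^2 of the orbit ring; see [dihedral_2torsion].  If 2 does not
    divide s, the proof shows that 2 divides s^2, then that 2 is not a geometric
    sum, so that 2 s = 0, and all terms of geom t 4 = 4 + 6 s + 4 s^2 + s^3 are
    divisible by 4. *)
Lemma geom4_dvd4 t : let s := t - 1 in nilelt (2 : K) -> nilelt s ->
    geom t 4 <> 0 ->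
    geometric t 2 \/ 2 * s = 0 ->
    geometric t (s ^+ 2) \/ s ^+ 3 = 0 ->
    [\/ geometric t 2, geometric t (s ^+ 2)
      | exists j, 2 = geom t j + t ^+ j * s ^+ 2] ->
  exists y, geom t 4 = 4 * y.
Proof.
move=> s n2 ns g4 H2 Hs Hc.
have g4E : geom t 4 = 2 * (2 + 3 * s + 2 * s ^+ 2) + s ^+ 3.
  by rewrite geom4 -/s; ring.
have [[v sv]|s_ndiv] := pselect (exists v, s = 2 * v).
  by exists ((1 + v) * (1 + s + v * s)); rewrite geom4 -/s expr2 {1 3}sv; ring.
have mod4 j u w : geom t j = 2 * u + s ^+ 2 * w ->
    exists x, geom t j = geom t 4 * x.
  by move=> /geom_mod4[] // [v sv]; case: s_ndiv; exists v.
(* Otherwise 2 would be a multiple of geom t 4, hence lie in (4, 2 s); so 2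
   would vanish, and with it geom t 4. *)
have two_ngeom v : s ^+ 3 = 2 * s * v -> ~ geometric t 2.
  move=> s3 [j jE]; have [|x xE] := mod4 j 1 0; first by rewrite -jE; ring.
  have g4v : geom t 4 = 2 * (2 + (3 + v + 2 * s) * s) by rewrite g4E s3; ring.
  pose y := 3 + v + 2 * s; apply: g4; rewrite g4v -/y.
  have [|z z2] := @nilelt_absorb _ 4 x (s * (y * x)) 2 (nileltMr _ ns).
    by rewrite {1}jE xE g4v -/y; ring.
  have -> : (2 : K) = 0; last by rewrite mul0r.
  by apply: (nilelt_fixed (nileltMr z n2)); rewrite {1}z2; ring.
have s2_geom : geometric t (s ^+ 2) -> exists v, s ^+ 2 = 2 * v.
  move=> [j jE]; have [|x xE] := mod4 j 0 1; first by rewrite -jE; ring.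
  apply: (@nilelt_absorb _ _ ((2 + 3 * s + 2 * s ^+ 2) * x) (s * x)).
    exact: nileltMr.
  by rewrite {1}jE xE g4E; ring.
(* If neither 2 nor s^2 is a geometric sum, then 2 s = s^3 = 0 and the coset
   relation reads 2 = geom t j + s^2 with geom t j a multiple of geom t 4. *)
have [v s2v] : exists v, s ^+ 2 = 2 * v.
  case: Hs => [/s2_geom//|s30].
  have n2g : ~ geometric t 2 by apply: (@two_ngeom 0); rewrite s30 mulr0.
  have s20 : 2 * s = 0 by case: H2.
  case: Hc => [//|/s2_geom //|[j jE]].
  have tj : t ^+ j * s ^+ 2 = s ^+ 2.
    transitivity (s ^+ 2 + s ^+ 3 * geom t j); last by rewrite s30 mul0r addr0.
    by rewrite exprS mulrAC (geom_mulB1 t j); ring.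
  have [|x xE] := mod4 j 1 (-1); first by rewrite jE tj; ring.
  exists (1 - (2 + 3 * s + 2 * s ^+ 2) * x).
  transitivity (2 - geom t j); first by rewrite {1}jE tj; ring.
  by rewrite xE g4E s30; ring.
have s3v : s ^+ 3 = 2 * s * v by rewrite exprS s2v; ring.
have s20 : 2 * s = 0 by case: H2 => // /(two_ngeom _ s3v).
exists (1 + s ^+ 2).
have -> : geom t 4 = 4 * (1 + s ^+ 2) + (2 * s) * (3 + v).
  by rewrite g4E s3v; ring.
by rewrite s20 mul0r addr0.
Qed.
End GeometricSums.

(** * The action of integer polynomials through an additive endomorphism *)

(** Commutative rings can thus be produced from an ideal given only by a
    predicate. *)
Lemma ideal_quotient (R : comNzRingType) (I : {pred R}) : idealr_closed I ->
  exists (K : comNzRingType) (pi : {rmorphism R -> K}),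
    forall x, (pi x == 0%R) = (x \in I).
Proof.
move=> Icl; pose J : idealr R := HB.pack (I : R -> bool) (isIdealr.Build R I Icl).
exists {ideal_quot J}, (\pi_{ideal_quot J}%qT : {rmorphism R -> {ideal_quot J}}).
move=> x; have pi0 : (\pi_{ideal_quot J} 0%R)%qT = 0%R by exact: rmorph0.
by rewrite -pi0 -Quotient.idealrBE subr0.
Qed.

Section PolynomialAction.
Variables (A : zmodType) (f : {additive A -> A}).
Implicit Types (p q : {poly int}) (x y : A).
Local Open Scope ring_scope.

(** This is q(f)(x); it makes A a module over the integer polynomials, with 'X
    acting as f. *)
Definition poly_act q x := \sum_(i < size q) iter i f x *~ q`_i.

Lemma poly_act_widen n q x : (size q <= n)%N ->
  poly_act q x = \sum_(i < n) iter i f x *~ q`_i.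
Proof.
move=> le_qn; rewrite /poly_act (big_ord_widen n (fun i => iter i f x *~ q`_i)) //.
rewrite big_mkcond; apply: eq_bigr => i _; case: ltnP => // /(nth_default 0) ->.
by rewrite mulr0z.
Qed.

Lemma poly_actB p q x : poly_act (p - q) x = poly_act p x - poly_act q x.
Proof.
pose n := maxn (size p) (size q).
have [le_pn le_qn] : (size p <= n)%N /\ (size q <= n)%N.
  by rewrite leq_maxl leq_maxr.
rewrite (poly_act_widen x le_pn) (poly_act_widen x le_qn) -sumrB.
rewrite (@poly_act_widen n); last first.
  by rewrite (leq_trans (size_polyD _ _)) // size_polyN.
by apply: eq_bigr => i _; rewrite coefB mulrzBr.
Qed.

Lemma poly_act0 x : poly_act 0 x = 0.
Proof. by rewrite /poly_act size_poly0 big_ord0. Qed.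

Lemma poly_actD p q x : poly_act (p + q) x = poly_act p x + poly_act q x.
Proof.
by rewrite -{1}[q]opprK poly_actB -[- q]sub0r poly_actB poly_act0 sub0r opprK.
Qed.

Lemma poly_actC a x : poly_act a%:P x = x *~ a.
Proof.
rewrite (@poly_act_widen 1) ?size_polyC ?leq_b1 // big_ord_recl big_ord0 addr0.
by rewrite coefC.
Qed.

Lemma poly_act_mulX q x : poly_act (q * 'X) x = poly_act q (f x).
Proof.
rewrite (@poly_act_widen (size q).+1).
  rewrite big_ord_recl coefMX mulr0z add0r; apply: eq_bigr => i _.
  by rewrite coefMX /= -iterS iterSr.
by rewrite (leq_trans (size_polyMleq _ _)) // size_polyX addn2.
Qed.

Lemma poly_act_is_additive q : zmod_morphism (poly_act q).
Proof.
move=> x y; rewrite /poly_act -sumrB; apply: eq_bigr => i _.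
by rewrite -mulrzBl; congr (_ *~ _); elim: (nat_of_ord i) => //= k ->; exact: raddfB.
Qed.

HB.instance Definition _ q :=
  GRing.isZmodMorphism.Build A A (poly_act q) (poly_act_is_additive q).

Lemma poly_actM p q x : poly_act (p * q) x = poly_act p (poly_act q x).
Proof.
rewrite mulrC; elim/poly_ind: q p x => [|q a IH] p x.
  by rewrite mul0r !poly_act0 (raddf0 (poly_act p)).
rewrite mulrDl !poly_actD raddfD /= mulrAC !poly_act_mulX IH; congr (_ + _).
rewrite mulrC; elim/poly_ind: p x => [|p b IHp] x.
  by rewrite mul0r !poly_act0.
rewrite mulrDl !poly_actD mulrAC !poly_act_mulX -polyCM !poly_actC IHp !poly_actC.
by rewrite raddfMz mulrzA mulrzAC.
Qed.

Lemma poly_act1 x : poly_act 1 x = x.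
Proof. exact: poly_actC. Qed.

Lemma poly_act_nat n x : poly_act n%:R x = x *+ n.
Proof.
by elim: n => [|n IH]; rewrite ?poly_act0 // -natr1 poly_actD IH poly_act1 mulrSr.
Qed.

Lemma poly_actX x : poly_act 'X x = f x.
Proof. by rewrite -['X]mul1r poly_act_mulX poly_act1. Qed.

Lemma poly_actXn n x : poly_act 'X^n x = iter n f x.
Proof.
elim: n x => [|n IH] x; first by rewrite expr0 poly_act1.
by rewrite exprSr poly_act_mulX IH iterSr.
Qed.

End PolynomialAction.

(** * Left braces: lambda maps and cyclic subgroups *)

Section BraceLambda.
Variable B : leftBraceType.
Implicit Types a b c x y : B.
Local Open Scope ring_scope.

Lemma brace_mul0 a : (a * 0%R)%g = a.
Proof.
have E := brace_mulD a 0 0; rewrite addr0 in E.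
apply/subr0_eq/(addrI (a * 0)%g); rewrite addr0 addrC.
exact: esym E.
Qed.

Lemma brace_one : (1%g : B) = 0%R.
Proof. by rewrite -(brace_mul0 1%g) mul1g. Qed.

Lemma brace_mulE a b : (a * b)%g = (a + brace_lambda a b)%R.
Proof. by rewrite /brace_lambda addNKr. Qed.

Lemma brace_lambda_is_additive a : zmod_morphism (brace_lambda a).
Proof.
move=> x y; rewrite /brace_lambda.
have := brace_mulD a (x - y)%R y; rewrite subrK => ->.
rewrite opprD opprK -addrA; congr (_ + _).
by rewrite addrACA subrK subrr addr0.
Qed.

HB.instance Definition _ a :=
  GRing.isZmodMorphism.Build B B (brace_lambda a) (brace_lambda_is_additive a).

Lemma brace_lambda1 x : brace_lambda 1%g x = x.
Proof. by rewrite /brace_lambda mul1g brace_one oppr0 add0r. Qed.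

Lemma brace_lambdaM a b x :
  brace_lambda (a * b)%g x = brace_lambda a (brace_lambda b x).
Proof.
rewrite [brace_lambda b x]/brace_lambda raddfD raddfN /=.
by rewrite /brace_lambda mulgA opprD opprK addrACA subrr add0r.
Qed.

Lemma iter_brace_lambda c n x :
  iter n (brace_lambda c) x = brace_lambda (c ^+ n)%g x.
Proof.
elim: n => [|n IH]; first by rewrite expg0 brace_lambda1.
by rewrite iterS IH expgS brace_lambdaM.
Qed.

(** Multiplying by c is the affine map x |-> c + lambda_c(x). *)
Lemma poly_act_geom c j :
  poly_act (brace_lambda c) (geom 'X j) c = (c ^+ j)%g.
Proof.
elim: j => [|j IH].
  by rewrite /geom big_ord0 poly_act0 expg0 brace_one.
rewrite geomS expgS brace_mulE poly_actD poly_act1 poly_actM IH.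
by rewrite poly_actX.
Qed.

End BraceLambda.

Lemma mulr2n_sub_eq0 (V : zmodType) (x y : V) :
  ((x *+ 2 - x - y *+ 2) *+ 2 = - (y *+ 2) -> (y - x) *+ 2 = 0)%R.
Proof.
have -> : (x *+ 2 - x = x)%R by rewrite mulr2n addrK.
rewrite (mulrnBl 2 x) (mulr2n (y *+ 2)%R) opprD addrA => /eqP.
rewrite -subr_eq0 opprK subrK subr_eq0 => /eqP xy.
by rewrite mulrnBl xy subrr.
Qed.

Lemma raddf_second_diff (V W : zmodType) (g : {additive V -> W}) (x y z : V) :
  g (x - y *+ 2 + z)%R = (g x - g y *+ 2 + g z)%R.
Proof. by rewrite raddfD raddfB raddfMn. Qed.

Lemma subr_second_diff (V : zmodType) (x y z : V) :
  (x - y - (y - z) = x - y *+ 2 + z)%R.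
Proof. by rewrite opprB mulr2n opprD !addrA addrAC. Qed.

Section CyclicOrbits.
Variables (B : leftBraceType) (c : B).
Implicit Types (b : B) (p q : {poly int}).
Local Open Scope ring_scope.
Local Notation act q := (poly_act (brace_lambda c) q c).

(** The quotient of the integer polynomials by the annihilator of c; as an
    additive group it is the lambda_c-submodule generated by c. *)
Lemma orbit_ring : c != 0 ->
  exists (K : comNzRingType) (pi : {rmorphism {poly int} -> K}),
    forall p q, pi p = pi q <-> act p = act q.
Proof.
move=> c_neq0; pose I : {pred {poly int}} := [pred q | act q == 0].
have Icl : idealr_closed I.
  split=> [||p u v]; rewrite !inE ?poly_act0 ?poly_act1 //.
  move=> /eqP u0 /eqP v0; rewrite poly_actD poly_actM u0 v0.
  by rewrite (raddf0 (poly_act _ p)) addr0.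
have [K [pi piE]] := ideal_quotient Icl; exists K, pi => p q.
have := piE (p - q); rewrite inE poly_actB raddfB !subr_eq0 => E.
by split=> /eqP; rewrite (E, =^~ E) => /eqP.
Qed.

(** The last clause is how the ring is used: it reduces the conclusion to one
    divisibility between a geometric sum of small length and its length. *)
Lemma orbit_ringP (p k f : nat) : prime p ->
    c *+ p ^ k = 0 -> (c ^+ (p ^ f))%g = 1%g -> (c ^+ (p ^ f.-1))%g != 1%g ->
  exists (K : comNzRingType) (pi : {rmorphism {poly int} -> K}),
    let t := pi 'X in
    [/\ forall p q, pi p = pi q <-> act p = act q,
        forall q j, pi q = geom t j <-> act q = (c ^+ j)%g,
        nilelt (p%:R : K), nilelt (t - 1) &
        forall e, (0 < e)%N -> (exists y, geom t (p ^ e) = (p ^ e)%:R * y) ->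
          (e < f)%N -> c *+ p ^ f.-1 <> 0].
Proof.
move=> p_pr ck cf cf1; have c_neq0 : c != 0.
  by apply: contraNneq cf1 => c0; rewrite c0 -brace_one expg1n.
have [K [pi piE]] := orbit_ring c_neq0; exists K, pi => t.
have geomE j : geom t j = pi (geom 'X j).
  by rewrite /geom rmorph_sum; apply: eq_bigr => i _; rewrite rmorphXn.
have actE q j : pi q = geom t j <-> act q = (c ^+ j)%g.
  by rewrite geomE -poly_act_geom.
have np : nilelt (p%:R : K).
  exists k; rewrite -natrX -(rmorph_nat pi) -(rmorph0 pi).
  by apply/piE; rewrite poly_act_nat poly_act0.
split=> //.
  apply: (nilelt_subr1 p_pr np (k := f)); rewrite -rmorphXn -(rmorph1 pi).
  by apply/piE; rewrite poly_actXn iter_brace_lambda cf brace_lambda1 poly_act1.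
move=> e e_gt0 ge lt_ef cf0; case/eqP: cf1.
have [|y yE] := geom_prime_lift e_gt0 ge (f := f.-1).
  by rewrite -ltnS (ltn_predK lt_ef).
rewrite brace_one -(poly_act0 (brace_lambda c) c); symmetry; apply/actE.
rewrite yE rmorph0 -(rmorph_nat pi).
have -> : pi (p ^ f.-1)%:R = pi 0 by apply/piE; rewrite poly_act_nat poly_act0.
by rewrite rmorph0 mul0r.
Qed.

(** The p-torsion being the set of powers of c, it contains lambda_c(c) - c,
    which is therefore a geometric sum in the orbit ring. *)
Lemma cyclic_odd_torsion (p k f : nat) : prime p -> odd p ->
    c *+ p ^ k = 0 -> (c ^+ (p ^ f))%g = 1%g -> (c ^+ (p ^ f.-1))%g != 1%g ->
    (forall b, b *+ p ^ k = 0 -> exists j, b = (c ^+ j)%g) ->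
  c *+ p ^ f.-1 <> 0.
Proof.
move=> p_pr p_odd ck cf cf1 gen.
have [K [pi [piE actE np ns lift]]] := orbit_ringP p_pr ck cf cf1.
have [|j jE] := gen (brace_lambda c c - c).
  by rewrite mulrnBl ck -raddfMn ck raddf0 subr0.
have [y yE] : exists y, geom (pi 'X) p = p%:R * y.
  apply: (@geom_odd_prime _ p j) => //; rewrite -(rmorph1 pi) -rmorphB.
  by apply/actE; rewrite poly_actB poly_actX poly_act1.
case: f cf cf1 lift => [|[|f]] cf cf1 lift.
- by rewrite cf eqxx in cf1.
- move=> c0; case/eqP: cf1; rewrite /= expn0 mulr1n in c0 *.
  by rewrite c0 -brace_one expg1n.
- by apply: (lift 1%N); rewrite ?expn1 //; exists y.
Qed.

(** An element b outside <c> satisfies lambda_b(b) = -b, as an involution, and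
    lambda_c(lambda_b(c)) = b - c - lambda_c(b), as it inverts c.  For b = 2 c
    this gives 2 s = 0 in the orbit ring, and for b = s^2 c it gives
    3 s^3 t = 0, whence s^3 = 0.  The bound on f makes c^4 nontrivial. *)
Lemma dihedral_2torsion (k f : nat) : (2 < f)%N ->
    c *+ 2 ^ k = 0 -> (c ^+ (2 ^ f))%g = 1%g -> (c ^+ (2 ^ f.-1))%g != 1%g ->
    (forall b, b *+ 2 ^ k = 0 -> (exists j, b = (c ^+ j)%g) \/
       [/\ (b * b)%g = 1%g, (c * b * c)%g = b &
           forall b', b' *+ 2 ^ k = 0 -> (exists j, b' = (c ^+ j)%g) \/
             exists j, b' = (c ^+ j * b)%g]) ->
  c *+ 2 ^ f.-1 <> 0.
Proof.
move=> f_gt2 ck cf cf1 dih.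
have [//|K [pi [piE actE n2 ns lift]]] := @orbit_ringP 2 k f _ ck cf cf1.
set t := pi 'X in actE ns lift; set s := t - 1 in ns.
have sE : s = pi ('X - 1) by rewrite rmorphB rmorph1.
pose l : {additive B -> B} := brace_lambda c.
pose v := l (l c) - l c *+ 2 + c.
have sqE x : poly_act l (('X - 1) ^+ 2) x = l (l x) - l x *+ 2 + x.
  rewrite expr2 poly_actM !poly_actB !poly_actX !poly_act1 raddfB /=.
  exact: subr_second_diff.
have vE : act (('X - 1) ^+ 2) = v by exact: sqE.
have tors2 : (c *+ 2) *+ 2 ^ k = 0 by rewrite mulrnAC ck mul0rn.
have torsl x : x *+ 2 ^ k = 0 -> l x *+ 2 ^ k = 0.
  by move=> x0; rewrite -(raddfMn l) x0 raddf0.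
have torsv : v *+ 2 ^ k = 0.
  by rewrite mulrnDl mulrnBl mulrnAC !torsl ?torsl // ck mul0rn subr0 addr0.
have two : (2 : K) = pi 2%:R by rewrite rmorph_nat.
have invol b : (b * b)%g = 1%g -> brace_lambda b b = - b.
  by move=> bb; apply/eqP; rewrite -addr_eq0 addrC -brace_mulE bb brace_one.
have flip b : (c * b * c)%g = b -> l (brace_lambda b c) = b - c - l b.
  move=> cbc; have /= E := cbc; rewrite -mulgA !brace_mulE raddfD /= in E.
  by rewrite -[X in X - c - _]E [c + _]addrC addrK [X in X - _]addrC addrK.
have conj b x : (c * b * c)%g = b ->
    l (brace_lambda b (l x)) = brace_lambda b x.
  by move=> cbc; rewrite -{2}cbc !brace_lambdaM.
have dvd4 : exists y, geom t 4 = 4 * y.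
  apply: geom4_dvd4 => //; rewrite -/s.
  - have g4E : geom t 4 = pi (geom 'X 4).
      by rewrite /geom rmorph_sum; apply: eq_bigr => i _; rewrite rmorphXn.
    rewrite g4E -(rmorph0 pi) => /piE; rewrite poly_act_geom poly_act0 -brace_one.
    move=> c4; case/eqP: cf1; have -> : f.-1 = (2 + (f - 3))%N by lia.
    by rewrite expnD expgM c4 expg1n.
  - have [[j cj]|[bb cbc _]] := dih _ tors2; [left|right].
      by exists j; rewrite two; apply/actE; rewrite poly_act_nat.
    rewrite two sE -rmorphM -(rmorph0 pi); apply/piE.
    rewrite poly_actM poly_act_nat poly_actB poly_actX poly_act1 poly_act0.
    apply: mulr2n_sub_eq0.
    rewrite -[X in _ - X](raddfMn l) -flip // -(raddfMn l).
    rewrite -(raddfMn (brace_lambda (c *+ 2))) /= (invol (c *+ 2)) //.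
    by rewrite raddfN (raddfMn (brace_lambda c)).
  - have [[j cj]|[bb cbc _]] := dih _ torsv; [left|right].
      by exists j; rewrite sE -rmorphXn; apply/actE; rewrite vE.
    (* Apply lambda_c three times to lambda_v(v) = -v.  Each lambda_c inside
       lambda_v cancels with one outside, so with x = lambda_v(c) the result
       is s^2 (lambda_c(x)) = - lambda_c^3(v), which is E. *)
    set x := brace_lambda v c; have lx : l x = v - c - l v by exact: flip.
    have lxE : act (('X - 1) ^+ 2 - 1 - 'X * ('X - 1) ^+ 2) = l x.
      by rewrite !poly_actB (poly_actM _ 'X) poly_actX poly_act1 vE lx.
    have E : poly_act l (('X - 1) ^+ 2) (l x) = - l (l (l v)).
      rewrite sqE; have <- : l (l (l (brace_lambda v v))) = - l (l (l v)).
        by rewrite invol // !raddfN.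
      have -> : brace_lambda v v =
          brace_lambda v (l (l c)) - brace_lambda v (l c) *+ 2 + x.
        exact: (raddf_second_diff (brace_lambda v)).
      by rewrite !(raddf_second_diff l) !(@conj v) // -/x addrC addrA addrAC.
    have : pi (('X - 1) ^+ 2 * (('X - 1) ^+ 2 - 1 - 'X * ('X - 1) ^+ 2)
               + 'X^3 * ('X - 1) ^+ 2) = pi 0.
      apply/piE; rewrite poly_actD poly_actM lxE E poly_act0.
      by rewrite (poly_actM _ 'X^3) poly_actXn vE addNr.
    rewrite !(rmorphD, rmorphM, rmorphB, rmorphXn, rmorph1, rmorph0) -/t -/s => F.
    (* F says 3 s^3 t = 0, and 3 = 4 - 1. *)
    have st0 : s ^+ 3 * t = 0.
      apply: (nilelt_fixed (nileltMr 2 n2)).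
      transitivity (4 * s ^+ 3 * t - 0); last by ring.
      by rewrite -F /s; ring.
    apply: (nilelt_fixed (nileltMr (-1) ns)); rewrite -[LHS]subr0 -st0.
    by rewrite (_ : t = 1 + s) /s; ring.
  - have [[j cj]|[_ _ H]] := dih _ torsv.
      by constructor 2; exists j; rewrite sE -rmorphXn; apply/actE; rewrite vE.
    have [[j cj]|[j cj]] := H _ tors2.
      by constructor 1; exists j; rewrite two; apply/actE; rewrite poly_act_nat.
    constructor 3; exists j; apply: (canRL (addrNK _)).
    rewrite two sE -!rmorphXn -rmorphM -rmorphB; apply/actE.
    rewrite poly_actB poly_act_nat poly_actM vE poly_actXn iter_brace_lambda.
    by rewrite cj brace_mulE addrK.
by apply: (lift 2).
Qed.
End CyclicOrbits.

(** * Finite abelian groups and dihedral groups *)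

Local Open Scope group_scope.

Section FiniteAdditiveGroup.
Variable A : finZmodType.
Implicit Types a b x : A.

Lemma zmod_exponent : exists e, [/\ 0 < e, e %| #|A|,
    forall d, (forall x, (x *+ d)%R = 0%R) <-> e %| d &
    e = #|A| <-> exists a, forall b, exists k : int, b = (a *~ k)%R].
Proof.
exists (exponent [set: A]); split; first exact: exponent_gt0.
- by rewrite -cardsT exponent_dvdn.
- move=> d; split=> [xd0|/exponentP xd x]; last exact: (xd x (in_setT x)).
  by apply/exponentP => x _; exact: xd0.
split=> [eA|[a aG]].
  have [a _ ae] := exponent_witness (abelian_nil (FinRing.zmod_abelian [set: A])).
  have defA : <[a]> = [set: A].
    by apply/eqP; rewrite eqEcard subsetT cardsT -eA ae leqnn.
  exists a => b; have : b \in <[a]> by rewrite defA inE.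
  by case/cycleP => k ->; exists k.
rewrite -cardsT exponent_cyclic //; apply/cyclicP; exists a.
apply/esym/setP => b; rewrite inE; have [[k|k] ->] := aG b.
  exact: mem_cycle.
by rewrite NegzE; exact: (groupVr (mem_cycle a k.+1)).
Qed.

(** The normal Sylow subgroup consists of all p-elements. *)
Lemma card_torsion p : prime p ->
  #|[set x : A | (x *+ p ^ logn p #|A|)%R == 0%R]| = (p ^ logn p #|A|)%N.
Proof.
move=> p_pr; have [S sylS] := Sylow_exists p [set: A].
have nS : S <| [set: A].
  by rewrite -sub_abelian_normal ?subsetT // FinRing.zmod_abelian.
have oS := card_Hall sylS; rewrite cardsT p_part in oS.
rewrite -[RHS]oS; apply: eq_card => x; rewrite inE.
apply/eqP/idP => [x0|Sx].
  rewrite (mem_normal_Hall sylS nS) ?inE // /p_elt.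
  have : (#[x] %| p ^ logn p #|A|)%N by rewrite order_dvdn; apply/eqP.
  by move=> ox; apply: (pnat_dvd ox); rewrite pnatX pnat_id.
by apply/eqP; rewrite -[_ == _]order_dvdn -oS order_dvdG.
Qed.

Lemma zmod_pfactor_dvd a p k f d : prime p -> (a *+ p ^ k)%R = 0%R ->
  (a *+ p ^ f.-1)%R <> 0%R -> (a *+ d)%R = 0%R -> (p ^ f %| d)%N.
Proof.
move=> p_pr ak af ad.
have /(dvdn_pfactor _ _ p_pr)[i _ oa] : (#[a] %| p ^ k)%N.
  by rewrite order_dvdn; apply/eqP.
have /(dvdn_trans _) : #[a] %| d by rewrite order_dvdn; apply/eqP.
apply; rewrite oa dvdn_exp2l // leqNgt; apply/negP => lt_if.
apply: af; apply/eqP; rewrite -[_ == _]order_dvdn oa dvdn_exp2l //.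
by rewrite -ltnS (ltn_predK lt_if).
Qed.

End FiniteAdditiveGroup.

(** C is the subgroup of rotations. *)
Lemma dihedral_structure q : 1 < q ->
  exists C : {group 'D_(2 * q)}, [/\ cyclic C, #|C| = q &
    forall g, g \notin C -> g * g = 1 /\ forall z, z \in C -> z ^ g = z^-1].
Proof.
move=> q_gt1; rewrite mul2n.
have /existsP[[x y] /=] := isoGrp_hom (Grp_dihedral q_gt1).
rewrite !xpair_eqE => /and4P[/eqP defG /eqP xq /eqP y2 /eqP xy].
have {}defG : <[x]> * <[y]> = [set: 'D_(q.*2)].
  by rewrite -norm_joinEr // norms_cycle xy groupV cycle_id.
have oG := card_dihedral q_gt1.
have ox : #[x] = q.
  apply/eqP; rewrite eqn_leq dvdn_leq ?order_dvdn ?xq ?(ltnW q_gt1) //=.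
  have : #|<[x]> * <[y]>| <= #[x] * 2.
    rewrite (leq_trans (dvdn_leq _ (dvdn_cardMg _ _))) ?muln_gt0 ?cardG_gt0 //.
    by rewrite leq_mul2l dvdn_leq ?orbT // order_dvdn y2.
  by rewrite defG oG muln2 leq_double.
have inv_y z : z \in <[x]> -> z ^ y = z^-1.
  by case/cycleP => k ->; rewrite conjXg xy expgVn.
exists <[x]>%G; split; rewrite ?cycle_cyclic // => g gC.
have /mulsgP[u v Cu /cycleP[j ->] gE] : g \in <[x]> * <[y]> by rewrite defG inE.
have {v}gE : g = u * y.
  move: gC; rewrite gE -(odd_double_half j) expgD -[j./2.*2]mul2n.
  rewrite expgM y2 expg1n mulg1.
  by case: (odd j); rewrite ?expg1 // expg0 mulg1 Cu.
rewrite gE; split=> [|z Cz].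
  have yV : y^-1 = y by apply/eqP; rewrite eq_invg_mul -expg2 y2.
  have := inv_y _ Cu; rewrite conjgE yV mulgA => E.
  by rewrite -mulgA [y * _]mulgA E mulgV.
rewrite conjgM (conjgE z u) (centsP (cycle_abelian x) _ Cz _ Cu) mulKg.
exact: inv_y.
Qed.

(** The addition is transported to T instead of making V finite, so that the
    algebraic and the finite structures live on the same type. *)
Lemma finite_zmodule (V : zmodType) (T : finType) (f : V -> T) :
  bijective f ->
  exists (A : finZmodType) (h : {additive A -> V}), bijective h /\ #|A| = #|T|.
Proof.
move=> [g fK gK].
pose add x y := f (g x + g y)%R; pose opp x := f (- g x)%R.
have addA : associative add by move=> x y z; rewrite /add !fK addrA.
have addC : commutative add by move=> x y; rewrite /add addrC.
have add0 : left_id (f 0%R) add by move=> x; rewrite /add fK add0r gK.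
have addN : left_inverse (f 0%R) opp add by move=> x; rewrite /add fK addNr.
pose A : finZmodType := HB.pack (T : Type) (Finite.on T)
  (Algebra.isZmodule.Build T addA addC add0 addN).
have g_add : zmod_morphism (g : A -> V).
  by move=> x y; exact: etrans (fK _) (congr1 (+%R (g x)) (fK _)).
pose h : {additive A -> V} := HB.pack (g : A -> V)
  (GRing.isZmodMorphism.Build A V g g_add).
exists A, h; split.
  exact: Bijective gK fK.
by apply: (bij_eq_card (f := id : A -> T)); exists id.
Qed.

(** * Left braces with a dihedral multiplicative group *)

Lemma compl_rcoset (gT : finGroupType) (C : {group gT}) x :
  #|gT| = (2 * #|C|)%N -> x \notin C -> C :* x = ~: C.
Proof.
move=> oG nCx; apply/eqP; rewrite eqEcard card_rcoset cardsCs setCK oG mul2n.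
rewrite -addnn addnK leqnn andbT; apply/subsetP => _ /rcosetP[y Cy ->].
by rewrite inE groupMl.
Qed.

Section DihedralBrace.
Variables (B : leftBraceType) (gT : finGroupType) (f : B -> gT) (g : gT -> B).
Hypotheses (fK : cancel f g) (gK : cancel g f) (fM : {morph f : a b / a * b}).
Variables (n m : nat) (C : {group gT}).
Hypotheses (n_gt3 : 3 < n) (odd_m : odd m).
Hypotheses (oG : #|gT| = (2 ^ n * m)%N) (oC : #|C| = (2 ^ n.-1 * m)%N).
Hypothesis cycC : cyclic C.
Hypothesis outC : forall x, x \notin C ->
  x * x = 1 /\ forall z, z \in C -> z ^ x = z^-1.

(** For each prime p, the additive p-torsion is a subgroup H.  For p odd it is
    contained in C, hence consists of the powers of one rotation; for p = 2 the
    rotations in H form a subgroup of index 2. *)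
Lemma dihedral_brace_torsion d :
  (forall b : B, (b *+ d)%R = 0%R) -> 2 ^ n.-1 * m %| d.
Proof.
move=> kill.
have m_gt0 : 0 < m by case: (m) odd_m.
have n_gt0 : 0 < n by exact: leq_trans n_gt3.
have [A [h [[h' hK h'K] oA]]] := finite_zmodule (Bijective fK gK).
have gM : {morph g : x y / x * y}.
  by move=> x y; rewrite -{1}(gK x) -{1}(gK y) -fM fK.
have g1 : g 1 = 1 by apply: (mulgI (g 1)); rewrite -gM !mulg1.
have gX x k : g (x ^+ k) = g x ^+ k.
  by elim: k => [|k IH]; rewrite ?expg0 // !expgS gM IH.
apply/dvdn_partP => [|p]; first by rewrite muln_gt0 expn_gt0.
rewrite mem_primes => /and3P[p_pr _ p_dvd]; rewrite p_part.
set k := logn p (2 ^ n * m); set e := logn p _.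
have kE : k = e + (p == 2).
  rewrite /k /e -(prednK n_gt0) expnS -mulnA lognM ?muln_gt0 ?expn_gt0 //.
  by rewrite logn_prime // addnC eq_sym.
pose H := [set x : gT | (g x *+ p ^ k)%R == 0%R].
have H_P x : (x \in H) = ((g x *+ p ^ k)%R == 0%R) by rewrite inE.
have oH : #|H| = (p ^ k)%N.
  have hA := card_torsion A p_pr; rewrite oA oG -/k in hA; rewrite -hA.
  have fh_inj : injective (f \o h).
    exact: inj_comp (can_inj fK) (can_inj hK).
  rewrite -(card_imset _ fh_inj); apply: eq_card => x; rewrite H_P.
  apply/eqP/imsetP => [gx|[a]]; last first.
    by rewrite inE => /eqP a0 -> /=; rewrite fK -raddfMn a0 raddf0.
  exists (h' (g x)); last by rewrite /= h'K gK.
  by rewrite inE -(inj_eq (can_inj hK)) raddfMn h'K gx raddf0.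
have gH : group_set H.
  apply/group_setP; split=> [|x y]; rewrite !H_P.
    by rewrite g1 brace_one mul0rn.
  move=> /eqP x0 /eqP y0; rewrite gM brace_mulE mulrnDl x0 -raddfMn.
  by rewrite y0 raddf0 addr0.
pose HG := Group gH; pose Z := (HG :&: C)%G.
have /cyclicP[z defZ] : cyclic Z by apply: cyclicS cycC; exact: subsetIr.
have odd_p : p != 2 -> odd p by case/even_prime: p_pr => // ->.
have e_gt0 : 0 < e.
  by rewrite logn_gt0 mem_primes p_pr p_dvd muln_gt0 expn_gt0 m_gt0.
(* The index of Z in H is at most 2, since that of C in the whole group is 2. *)
have oz : #[z] = (p ^ e)%N.
  have /(dvdn_pfactor _ _ p_pr)[i _ oZ] : #|Z| %| p ^ k.
    by rewrite -oH; apply: (cardSg (subsetIl HG C)).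
  rewrite orderE -defZ oZ; congr (_ ^ _)%N; apply/eqP; rewrite eqn_leq.
  have -> /= : i <= e.
    rewrite -pfactor_dvdn ?muln_gt0 ?expn_gt0 // -oZ -oC.
    exact: cardSg (subsetIr HG C).
  have le_k : p ^ k <= 2 * p ^ i.
    have C_gt0 := cardG_gt0 C; rewrite -(leq_pmul2r C_gt0) -oH (mul_cardG HG C).
    have -> : #|HG :&: C| = (p ^ i)%N by [].
    rewrite mulnAC leq_mul2r; apply/orP; right.
    by rewrite oC mulnA -expnS (prednK n_gt0) -oG max_card.
  have [p2|p_neq2] := eqVneq p 2.
    by move: le_k; rewrite kE p2 eqxx addn1 -expnS leq_exp2l.
  rewrite -ltnS -(ltn_exp2l _ _ (prime_gt1 p_pr)).
  move: le_k; rewrite kE (negbTE p_neq2) addn0 => /leq_ltn_trans; apply.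
  by rewrite expnS ltn_pmul2r ?expn_gt0 ?prime_gt0 // odd_prime_gt2 ?odd_p.
have Zz : z \in Z by rewrite defZ cycle_id.
have /setIP[Hz Cz] := Zz.
have zX x : x \in Z -> exists j, g x = g z ^+ j.
  by rewrite defZ => /cycleP[j ->]; exists j; rewrite gX.
have ck : (g z *+ p ^ k)%R = 0%R by apply/eqP; rewrite -H_P.
have ce : g z ^+ (p ^ e) = 1 by rewrite -gX -oz expg_order g1.
have ce1 : g z ^+ (p ^ e.-1) != 1.
  rewrite -gX -g1 (inj_eq (can_inj gK)) -order_dvdn oz dvdn_Pexp2l ?prime_gt1 //.
  by rewrite -ltnNge ltn_predL.
have {}mem_H b : (b *+ p ^ k)%R = 0%R -> f b \in H.
  by move=> b0; rewrite H_P fK b0.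
have ne0 : (g z *+ p ^ e.-1)%R <> 0%R.
  have [p2|p_neq2] := eqVneq p 2; last first.
    apply: (cyclic_odd_torsion p_pr (odd_p p_neq2) ck ce ce1) => b /mem_H Hfb.
    rewrite -(fK b); apply: zX; suff -> : Z = HG by [].
    apply/val_inj/eqP; rewrite eqEcard subsetIl /= oH.
    have -> : #|HG :&: C| = #[z] by rewrite orderE -defZ.
    by rewrite oz kE (negbTE p_neq2) addn0.
  have e_gt2 : 2 < e.
    rewrite /e p2 lognM ?expn_gt0 // pfactorK // lognE.
    by rewrite dvdn2 odd_m !andbF addn0 -ltnS prednK.
  subst p; apply: (dihedral_2torsion e_gt2 ck ce ce1) => b /mem_H Hfb.
  have [Cfb|nCfb] := boolP (f b \in C); [left|right].
    by rewrite -(fK b); apply: zX; rewrite inE Hfb.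
  have [bb binv] := outC nCfb; split=> [||b' /mem_H Hfb'].
  - by rewrite -g1 -bb gM fK.
  - apply: (can_inj fK).
    by rewrite !fM gK (conjgC z (f b)) (binv z Cz) mulgKV.
  have [Cfb'|nCfb'] := boolP (f b' \in C); [left|right].
    by rewrite -(fK b'); apply: zX; rewrite inE Hfb'.
  have [|j jE] := zX (f b' * (f b)^-1); last first.
    by exists j; rewrite -jE -{2}(fK b) -gM mulgKV fK.
  apply/setIP; split; first by apply: (@groupM _ HG) => //; rewrite groupV.
  by rewrite -mem_rcoset compl_rcoset ?inE // oG oC mulnA -expnS prednK.
apply: (@zmod_pfactor_dvd A (h' (g z)) p k e d) => //.
- by apply: (can_inj hK); rewrite raddfMn h'K ck raddf0.
- by move=> /(congr1 h); rewrite raddfMn h'K raddf0.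
- by apply: (can_inj hK); rewrite raddfMn h'K kill raddf0.
Qed.
End DihedralBrace.

(** * The Dehornoy class as an additive exponent *)

Section DehornoyClass.
Variables (X : Type) (r : solution X).
Implicit Types (x y : X) (g : perm_group r).

Lemma Omega_ext k (t u : 'I_k.+1 -> X) : t =1 u -> Omega r t = Omega r u.
Proof. by move/funext->. Qed.

(** Dropping either of the last two arguments leaves a tuple of the same shape,
    with last argument x or y.  The induction step is therefore one application
    of [shift], that is, the addition of one more sigma_x. *)
Lemma Omega_constE k x y :
  Omega r (fun i : 'I_k.+1 => if i < k then x else y) = (gsigma r x *+ k)%R^-1 y.
Proof.
elim: k y => [|k IH] y.
  by rewrite mulr0n; rewrite -[RHS](sym1E); congr (_ y); rewrite invg1.
rewrite /= -/(Omega r); set a := Omega r _; set b := Omega r _.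
have bE : b = (gsigma r x *+ k)%R^-1 y.
  rewrite -IH; apply: Omega_ext => i /=; rewrite /bump inordK ?(leqW (leqnn _)) //.
  have [lt_ik|le_ki] := ltnP i k; first by rewrite add0n ltnS ltnW.
  by rewrite add1n ltnS ltnNge le_ki.
have aE : a = (gsigma r x *+ k)%R^-1 x.
  rewrite -IH; apply: Omega_ext => i.
  by rewrite /= /bump (leqNgt k.+1 i) ltn_ord add0n ltn_ord if_same.
rewrite aE bE mulrS -shiftE /shift; symmetry.
set g := (gsigma r x *+ k)%R; exact: (gmulV_app g (gsigma r (g^-1 x)) y).
Qed.

(** The group acts faithfully on X, so the multiples of the sigma_x vanish; and
    every element is reached from 0 by adding and subtracting sigma_x's. *)
Lemma dehornoy_trivialE d :
  dehornoy_trivial r d <-> forall g, (g *+ d)%R = 0%R.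
Proof.
split=> [triv g|kill x y]; last first.
  rewrite Omega_constE kill.
  exact: (congr1 (fun u : perm_group r => u y) (invg1 _)).
have gens x : (gsigma r x *+ d)%R = 0%R.
  apply: perm_group_ext => y; rewrite -{1}(triv x y) Omega_constE.
  exact: symKV.
rewrite -(gtrans1 g); elim: (gtransP g) => [|x a _ IH|x a _ IH] /=.
- exact: mul0rn.
- by rewrite shiftE mulrnDl gens IH addr0.
have -> : unshift x (a 1) = (a 1%g - gsigma r x)%R.
  by rewrite -{2}(unshiftK x (a 1)) shiftE addrC addKr.
by rewrite mulrnBl gens IH subr0.
Qed.

End DehornoyClass.

Local Close Scope group_scope.

Theorem proposition5p11 (X : Type) (r : solution X) (n m : nat)
  (hn : 3 < n) (hm : odd m)
  (hdih : isomorphic_groups (perm_group r) 'D_(2 ^ n * m)) :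
  (cyclic_brace (perm_group r) -> is_dehornoy_class r (2 ^ n * m)) /\
  (~ cyclic_brace (perm_group r) -> is_dehornoy_class r (2 ^ n.-1 * m)).
Proof.
have [f [g fK gK] fM] := hdih.
have m_gt0 : 0 < m by case: (m) hm.
have n_gt0 : 0 < n by exact: leq_trans hn.
have NE : (2 ^ n * m)%N = (2 * (2 ^ n.-1 * m))%N by rewrite mulnA -expnS prednK.
have q_gt1 : 1 < 2 ^ n.-1 * m.
  rewrite (leq_trans _ (leq_pmulr _ m_gt0)) // (leq_exp2l 1) //.
  by rewrite -ltnS prednK // ltnW // ltnW.
have [A [h [[h' hK h'K] oA]]] := finite_zmodule (Bijective fK gK).
have oD : #|'D_(2 ^ n * m)| = (2 ^ n * m)%N.
  by rewrite -cardsT NE mul2n card_dihedral.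
have [e [e_gt0 e_dvd eP cycP]] := zmod_exponent A.
have eB d : dehornoy_trivial r d <-> e %| d.
  rewrite dehornoy_trivialE -eP; split=> kill x.
    by apply: (can_inj hK); rewrite raddfMn kill raddf0.
  by rewrite -(h'K x) -raddfMn kill raddf0.
have cyc : cyclic_brace (perm_group r) <-> e = (2 ^ n * m)%N.
  rewrite -{1}oD -oA cycP; split=> -[a aG].
    by exists (h' a) => b; have [k bE] := aG (h b); exists k;
       apply: (can_inj hK); rewrite raddfMz h'K.
  by exists (h a) => b; have [k bE] := aG (h' b); exists k;
     rewrite -raddfMz -bE h'K.
have classP : is_dehornoy_class r e.
  split=> // [|d d_gt0 /eB]; [exact/eB | exact: dvdn_leq].
have half_dvd : 2 ^ n.-1 * m %| e.
  move: f g fK gK fM oD; rewrite NE => f' g' f'K g'K f'M oD.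
  have [C [cycC oC outC]] := dihedral_structure q_gt1.
  apply: (dihedral_brace_torsion f'K g'K f'M hn hm _ oC cycC outC).
    by rewrite oD NE.
  by apply/dehornoy_trivialE/eB.
split=> [/cyc <- //|ncyc].
suff <- : e = (2 ^ n.-1 * m)%N by [].
have /dvdnP[q eq] := half_dvd.
move: e_dvd; rewrite oA oD NE eq dvdn_pmul2r ?(ltnW q_gt1) //.
case: q eq => [|[|[|q]]] eq // _; first by rewrite mul1n in eq *.
by case: ncyc; apply/cyc; rewrite eq NE.
Qed.
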